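(* Let $B\times_fF$ be a degenerate warped product, let $X,Y,Z\in\Gamma(TB)$ and $U,V,W\in\Gamma(TF)$ (lifted to $B\times F$), and let $P\in\Gamma(TF)$ (lifted). Let $\overline{\mathcal K}$ be the semi-symmetric metric Koszul form on $B\times_fF$ associated with $P$, and let $\mathcal K_B$, $\mathcal K_F$ be the lifts of the Koszul forms of $(B,g_B)$, $(F,g_F)$. Then: (1) $\overline{\mathcal K}(X,Y,Z)=\mathcal K_B(X,Y,Z)$; (2) $\overline{\mathcal K}(X,Y,W)=-\overline{\mathcal K}(X,W,Y)=-f^2g_B(X,Y)g_F(P,W)$; (3) $\overline{\mathcal K}(W,X,Y)=0$; (4) $\overline{\mathcal K}(X,V,W)=\overline{\mathcal K}(V,X,W)=-\overline{\mathcal K}(V,W,X)=f\,g_F(V,W)\,X(f)$; (5) $\overline{\mathcal K}(U,V,W)=f^2\mathcal K_F(U,V,W)+f^4g_F(V,P)g_F(U,W)-f^4g_F(U,V)g_F(P,W)$.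
   Context: A singular semi-Riemannian manifold is a smooth manifold with a smooth symmetric $(0,2)$-tensor field $g=\langle\cdot,\cdot\rangle$, possibly degenerate and of varying signature. Its Koszul form is $\mathcal K(X,Y,Z)=\tfrac12\{X\langle Y,Z\rangle+Y\langle Z,X\rangle-Z\langle X,Y\rangle-\langle X,[Y,Z]\rangle+\langle Y,[Z,X]\rangle+\langle Z,[X,Y]\rangle\}$, and the semi-symmetric metric Koszul form associated with a vector field $P$ is $\overline{\mathcal K}(X,Y,Z)=\mathcal K(X,Y,Z)+g(Y,P)g(X,Z)-g(X,Y)g(P,Z)$. Let $(B,g_B)$, $(F,g_F)$ be singular semi-Riemannian manifolds and $f\in C^\infty(B)$ (which may vanish at some points). The (degenerate) warped product $B\times_fF$ is $B\times F$ with the metric $\pi_B^*(g_B)+(f\circ\pi_B)^2\pi_F^*(g_F)$, where $\pi_B,\pi_F$ are the projections. Functions, vector fields and forms on $B$ and $F$ are identified with their lifts to $B\times F$. *)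

(* Defs.v *)
From HB Require Import structures.
From mathcomp Require Import all_boot all_order all_algebra.
From mathcomp Require Import boolp classical_sets functions cardinality.
From mathcomp Require Import reals topology normedtype derive.
From mathcomp Require Import ring.
Set Implicit Arguments.
Unset Strict Implicit.
Unset Printing Implicit Defensive.
Import Order.TTheory GRing.Theory Num.Theory.
Import numFieldNormedType.Exports.
Local Open Scope classical_set_scope.
Local Open Scope ring_scope.

Notation "''e_' i" := (delta_mx 0 i) (at level 8, i at level 2, format "''e_' i").

Section euclidean.
Context {R : realType}.


(* f is C^k on the open set U: all partial derivatives of f of order at most k
   exist and are continuous on U. Values of f outside U are irrelevant. *)
Fixpoint Ck {n} (k : nat) (U : set 'rV[R]_n) (f : 'rV[R]_n -> R) : Prop :=
  (forall x, U x -> {for x, continuous f}) /\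
  if k is k'.+1 then forall i : 'I_n,
    (forall x, U x -> derivable f x 'e_i) /\ Ck k' U ('D_'e_i f)
  else True.

Definition smooth_on {n} (U : set 'rV[R]_n) (f : 'rV[R]_n -> R) : Prop :=
  forall k, Ck k U f.

Lemma Ck_cont n k (U : set 'rV[R]_n) f :
  Ck k U f -> forall x, U x -> {for x, continuous f}.
Proof. by case: k => [|k] []. Qed.

Lemma Ck_sub n k (U V : set 'rV[R]_n) f : V `<=` U -> Ck k U f -> Ck k V f.
Proof.
move=> VU; elim: k f => [|k IH] f [fc fd]; split=> //; try by move=> x /VU /fc.
move=> i; have [di ki] := fd i; split; first by move=> x /VU /di.
exact: IH.
Qed.

Lemma Ck_ext n k (U : set 'rV[R]_n) f g : open U ->
  (forall x, U x -> f x = g x) -> Ck k U f -> Ck k U g.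
Proof.
move=> oU fg fC.
have near_fg (f1 g1 : 'rV[R]_n -> R) x : (forall x, U x -> f1 x = g1 x) -> U x ->
    {near x, f1 =1 g1}.
  by move=> E Ux; apply: filterS (open_nbhs_nbhs (conj oU Ux)) => y Uy; exact/E.
have cont_fg (f1 g1 : 'rV[R]_n -> R) x : (forall x, U x -> f1 x = g1 x) -> U x ->
    {for x, continuous f1} -> {for x, continuous g1}.
  move=> E Ux fx; rewrite /prop_for /continuous_at -(E _ Ux).
  by apply: cvg_trans fx; apply: (@near_eq_cvg _ _ (nbhs x)); exact: near_fg.
elim: k f g fg fC => [|k IH] f g fg [fc fd].
  by split=> // x Ux; apply: cont_fg (fc _ Ux).
split=> [x Ux|]; first exact: cont_fg (fc _ Ux).
move=> i; have [di ki] := fd i; split=> [x Ux|].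
  apply: near_eq_derivable (di _ Ux); exact: near_fg.
apply: IH ki => x Ux; apply: near_eq_derive => //.
exact: near_fg.
Qed.

Lemma CkW n k (U : set 'rV[R]_n) f : Ck k.+1 U f -> Ck k U f.
Proof.
elim: k f => [|k IH] f [fc fd]; split=> // i.
by have [di ki] := fd i; split=> //; exact: IH.
Qed.

Lemma Ck_cst n k (U : set 'rV[R]_n) (a : R) : Ck k U (fun=> a).
Proof.
elim: k a => [|k IH] a; first by split=> // x _; exact: cst_continuous.
split=> [x _|i]; first exact: cst_continuous.
split=> [x _|]; first exact: derivable_cst.
rewrite (_ : 'D_'e_i _ = fun=> 0) //.
by apply/funext => x; exact: derive_cst.
Qed.

Lemma CkD n k (U : set 'rV[R]_n) f g : open U ->
  Ck k U f -> Ck k U g -> Ck k U (fun x => f x + g x).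
Proof.
move=> oU; elim: k f g => [|k IH] f g [fc fd] [gc gd].
  by split=> // x Ux; apply: continuousD; [exact: fc|exact: gc].
split=> [x Ux|i]; first by apply: continuousD; [exact: fc|exact: gc].
have [di ki] := fd i; have [ei li] := gd i.
split=> [x Ux|]; first by apply: derivableD; [exact: di|exact: ei].
apply: (Ck_ext (f := fun x => 'D_'e_i f x + 'D_'e_i g x)) => //.
  by move=> x Ux; rewrite -deriveD //; [exact: di|exact: ei].
exact: IH.
Qed.

Lemma CkM n k (U : set 'rV[R]_n) f g : open U ->
  Ck k U f -> Ck k U g -> Ck k U (fun x => f x * g x).
Proof.
move=> oU; elim: k f g => [|k IH] f g fC gC.
  split=> // x Ux; apply: continuousM; [exact: (Ck_cont fC)|exact: (Ck_cont gC)].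
have [fc fd] := fC; have [gc gd] := gC.
split=> [x Ux|i]; first by apply: continuousM; [exact: fc|exact: gc].
have [di ki] := fd i; have [ei li] := gd i.
split=> [x Ux|]; first by apply: derivableM; [exact: di|exact: ei].
apply: (Ck_ext (f := fun x => f x * 'D_'e_i g x + g x * 'D_'e_i f x)).
- by [].
- by move=> x Ux; rewrite -deriveM //; [exact: di|exact: ei].
- by apply: CkD => //; apply: IH => //; exact: CkW.
Qed.

Lemma derive_affine m n (A : 'rV[R]_m -> 'rV[R]_n) (v : 'rV[R]_m)
    (w : 'rV[R]_n) (f : 'rV[R]_n -> R) :
  (forall h x, A (h *: v + x) = h *: w + A x) ->
  (forall x, derivable f (A x) w -> derivable (f \o A) x v) /\
  'D_v (f \o A) = fun x => 'D_w f (A x).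
Proof.
move=> Avw.
have E x : (fun h : R => h^-1 *: (((f \o A) \o shift x) (h *: v) - (f \o A) x))
    = (fun h => h^-1 *: ((f \o shift (A x)) (h *: w) - f (A x))).
  by apply/funext => h /=; rewrite Avw.
split=> [x|]; first by rewrite /derivable E.
by apply/funext => x; rewrite /derive E.
Qed.

(* Affine maps whose linear part sends each basis vector to a basis vector or
   to 0; projections and slice inclusions of products are of this form. *)
Definition affine_map m n (A : 'rV[R]_m -> 'rV[R]_n) :=
  continuous A /\ forall i, exists2 w,
    forall h x, A (h *: 'e_i + x) = h *: w + A x &
    w = 0 \/ exists j, w = 'e_j.

Lemma Ck_affine m n k (U : set 'rV[R]_n) (V : set 'rV[R]_m) A
    (f : 'rV[R]_n -> R) :
  affine_map A -> (forall x, V x -> U (A x)) -> Ck k U f -> Ck k V (f \o A).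
Proof.
move=> [Ac Ad] VU; elim: k f => [|k IH] f fC.
  by split=> // x Vx; apply: continuous_comp; [exact: Ac|apply: (Ck_cont fC (VU _ Vx))].
have [fc fd] := fC.
split=> [x Vx|i].
  by apply: continuous_comp; [exact: Ac|exact: fc (VU _ Vx)].
have [w Aw w0] := Ad i; have [Dder Deq] := derive_affine f Aw.
case: w0 => [w0|[j wj]].
  split=> [x Vx|]; first by apply: (Dder x); rewrite w0; exact: derivable0.
  rewrite Deq w0 (_ : (fun _ => _) = fun=> 0); first exact: Ck_cst.
  by apply/funext => x; exact: derive0.
have [dj kj] := fd j; split=> [x Vx|].
  by apply: (Dder x); rewrite wj; exact: dj (VU _ Vx).
by rewrite Deq wj; exact: (IH ('D_'e_j f) kj).
Qed.

Lemma smooth_on_affine m n (U : set 'rV[R]_n) (V : set 'rV[R]_m) A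
    (f : 'rV[R]_n -> R) :
  affine_map A -> (forall x, V x -> U (A x)) ->
  smooth_on U f -> smooth_on V (f \o A).
Proof. by move=> hA VU fs k; exact: Ck_affine (fs k). Qed.

Lemma smooth_on_sum n (U : set 'rV[R]_n) (I : Type) (r : seq I)
    (F : I -> 'rV[R]_n -> R) : open U ->
  (forall i, smooth_on U (F i)) -> smooth_on U (fun x => \sum_(i <- r) F i x).
Proof.
move=> oU Fs k; elim: r => [|i r IH].
  by under eq_fun do rewrite big_nil; exact: Ck_cst.
under eq_fun do rewrite big_cons.
by apply: CkD => //; exact: Fs.
Qed.

Lemma smooth_onM n (U : set 'rV[R]_n) f g : open U ->
  smooth_on U f -> smooth_on U g -> smooth_on U (fun x => f x * g x).
Proof. by move=> oU fs gs k; exact: CkM. Qed.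

Lemma smooth_onD n (U : set 'rV[R]_n) f g : open U ->
  smooth_on U f -> smooth_on U g -> smooth_on U (fun x => f x + g x).
Proof. by move=> oU fs gs k; exact: CkD. Qed.

Lemma smooth_on_cst n (U : set 'rV[R]_n) a : smooth_on U (fun=> a).
Proof. by move=> k; exact: Ck_cst. Qed.

Lemma smooth_on_ext n (U : set 'rV[R]_n) f g : open U ->
  (forall x, U x -> f x = g x) -> smooth_on U f -> smooth_on U g.
Proof. by move=> oU fg fs k; apply: Ck_ext (fs k). Qed.

Lemma smooth_on_derive n (U : set 'rV[R]_n) f i :
  smooth_on U f -> smooth_on U ('D_'e_i f).
Proof. by move=> fs k; have [_ /(_ i)[]] := fs k.+1. Qed.

Lemma mx_continuous (T : topologicalType) m n (A : T -> 'M[R]_(m, n)) x :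
  (forall i j, continuous_at x (fun y => A y i j)) -> continuous_at x A.
Proof.
move=> Ac P [Q Qn QP].
have H : \forall y \near x, forall i j, Q i j (A y i j).
  by apply: filter_forall => i; apply: filter_forall => j; exact: Ac.
by apply: filterS H => y Qy; apply: QP => i j; exact: Qy.
Qed.

Lemma lsubmx_affine m n : affine_map (lsubmx : 'rV[R]_(m + n) -> 'rV[R]_m).
Proof.
split=> [x|i].
  apply: mx_continuous => a b.
  rewrite (_ : (fun y => _) = fun y : 'rV[R]__ => y a (lshift n b)).
    exact: coord_continuous.
  by apply/funext => y; rewrite mxE.
exists (lsubmx 'e_i) => [h x|]; first by rewrite linearP.
case: (split_ordP i) => j ->; [right; exists j|left]; apply/rowP => l.
  by rewrite !mxE eqxx eq_lshift.
by rewrite !mxE eqxx eq_lrshift.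
Qed.

Lemma rsubmx_affine m n : affine_map (rsubmx : 'rV[R]_(m + n) -> 'rV[R]_n).
Proof.
split=> [x|i].
  apply: mx_continuous => a b.
  rewrite (_ : (fun y => _) = fun y : 'rV[R]__ => y a (rshift m b)).
    exact: coord_continuous.
  by apply/funext => y; rewrite mxE.
exists (rsubmx 'e_i) => [h x|]; first by rewrite linearP.
case: (split_ordP i) => j ->; [left|right; exists j]; apply/rowP => l.
  by rewrite !mxE eqxx eq_rlshift.
by rewrite !mxE eqxx eq_rshift.
Qed.

Lemma row_mx_deltal m n (i : 'I_m) :
  row_mx 'e_i 0 = 'e_(lshift n i) :> 'rV[R]_(m + n).
Proof.
apply/rowP => k; rewrite !mxE; case: split_ordP => j ->; rewrite !mxE eqxx.
  by rewrite eq_lshift.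
by rewrite eq_rlshift.
Qed.

Lemma row_mx_deltar m n (i : 'I_n) :
  row_mx 0 'e_i = 'e_(rshift m i) :> 'rV[R]_(m + n).
Proof.
apply/rowP => k; rewrite !mxE; case: split_ordP => j ->; rewrite !mxE eqxx.
  by rewrite eq_lrshift.
by rewrite eq_rshift.
Qed.

Lemma row_mx_addl m n (v x : 'rV[R]_m) (y : 'rV[R]_n) h :
  row_mx (h *: v + x) y = h *: row_mx v 0 + row_mx x y.
Proof. by rewrite scale_row_mx scaler0 add_row_mx add0r. Qed.

Lemma row_mx_addr m n (x : 'rV[R]_m) (v y : 'rV[R]_n) h :
  row_mx x (h *: v + y) = h *: row_mx 0 v + row_mx x y.
Proof. by rewrite scale_row_mx scaler0 add_row_mx add0r. Qed.

Lemma row_mx_affinel m n (y : 'rV[R]_n) :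
  affine_map (fun x : 'rV[R]_m => row_mx x y).
Proof.
split=> [x|i].
  apply: mx_continuous => a b; case: (split_ordP b) => j ->.
    rewrite (_ : (fun y' => _) = fun y' : 'rV[R]_m => y' a j).
      exact: coord_continuous.
    by apply/funext => y'; rewrite row_mxEl.
  rewrite (_ : (fun y' => _) = fun=> y a j); first exact: cst_continuous.
  by apply/funext => y'; rewrite row_mxEr.
exists (row_mx 'e_i 0) => [h x|]; first exact: row_mx_addl.
by right; exists (lshift n i); exact: row_mx_deltal.
Qed.

Lemma row_mx_affiner m n (x : 'rV[R]_m) :
  affine_map (fun y : 'rV[R]_n => row_mx x y).
Proof.
split=> [y|i].
  apply: mx_continuous => a b; case: (split_ordP b) => j ->.
    rewrite (_ : (fun y' => _) = fun=> x a j); first exact: cst_continuous.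
    by apply/funext => y'; rewrite row_mxEl.
  rewrite (_ : (fun y' => _) = fun y' : 'rV[R]_n => y' a j).
    exact: coord_continuous.
  by apply/funext => y'; rewrite row_mxEr.
exists (row_mx 0 'e_i) => [h y|]; first exact: row_mx_addr.
by right; exists (rshift m i); exact: row_mx_deltar.
Qed.

End euclidean.

Section manifolds.
Context {R : realType}.

Record chart (M : topologicalType) (n : nat) := Chart {
  dom : set M;
  chart_map :> M -> 'rV[R]_n;
  chart_inv : 'rV[R]_n -> M;
  chart_dom_open : open dom;
  chart_im_open : open (chart_map @` dom);
  chart_mapK : forall p, dom p -> chart_inv (chart_map p) = p;
  chart_map_cont : forall p, dom p -> {for p, continuous chart_map};
  chart_inv_cont : forall x, (chart_map @` dom) x -> {for x, continuous chart_inv} }.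

Definition im M n (c : chart M n) : set 'rV[R]_n := c @` dom c.

(* Smooth n-manifolds, presented by an atlas that need not be maximal: smoothness
   of functions, fields and tensors is the same tested on any one atlas. *)
Record manifold (n : nat) := Manifold {
  carrier :> topologicalType;
  manifold_hausdorff : hausdorff_space carrier;
  manifold_second_countable : @second_countable carrier;
  atlas : set (chart carrier n);
  atlas_cover : forall p, exists2 c, atlas c & dom c p;
  atlas_compat : forall c d, atlas c -> atlas d -> forall j : 'I_n,
    smooth_on (c @` (dom c `&` dom d)) (fun x => d (chart_inv c x) 0 j) }.

Definition smooth n (M : manifold n) (h : M -> R) : Prop :=
  forall c, atlas c -> smooth_on (im c) (h \o chart_inv c).

Definition smooth_pred n (M : manifold n) : {pred M -> R^o} :=
  fun h => `[< smooth h >].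

Arguments smooth_pred {n} M _.

(* The algebra of smooth functions on M. *)
Record cinf n (M : manifold n) := Cinf {
  cinf_fun :> M -> R^o;
  cinf_in : cinf_fun \in smooth_pred M }.

Lemma cinf_smooth n (M : manifold n) (h : cinf M) : smooth h.
Proof. exact/asboolP/cinf_in. Qed.

Definition mk_cinf n (M : manifold n) (h : M -> R) (hs : smooth h) : cinf M :=
  Cinf (introT (asboolP _) hs : h \in smooth_pred M).

HB.instance Definition _ n (M : manifold n) :=
  [isSub of cinf M for @cinf_fun n M].
HB.instance Definition _ n (M : manifold n) := [Choice of cinf M by <:].

Lemma im_is_open M n (c : chart M n) : open (im c).
Proof. exact: chart_im_open. Qed.

Lemma smooth_subring n (M : manifold n) : subring_closed (smooth_pred M).
Proof.
split=> [|h k /asboolP hs /asboolP ks|h k /asboolP hs /asboolP ks];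
  apply/asboolP => c ac.
- exact: smooth_on_cst.
- apply: (smooth_on_ext (f := fun x => h (chart_inv c x) + (-1) * k (chart_inv c x))).
  + exact: im_is_open.
  + by move=> x _ /=; rewrite mulN1r.
  + apply: smooth_onD; [exact: im_is_open|exact: hs|].
    by apply: smooth_onM; [exact: im_is_open|exact: smooth_on_cst|exact: ks].
- by apply: smooth_onM; [exact: im_is_open|exact: hs|exact: ks].
Qed.

Lemma smooth_submod n (M : manifold n) : submod_closed (smooth_pred M).
Proof.
split=> [|a h k /asboolP hs /asboolP ks]; apply/asboolP => c ac.
  exact: smooth_on_cst.
apply: smooth_onD; [exact: im_is_open| |exact: ks].
by apply: smooth_onM; [exact: im_is_open|exact: smooth_on_cst|exact: hs].
Qed.

HB.instance Definition _ n (M : manifold n) :=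
  GRing.isSubringClosed.Build _ (smooth_pred M) (smooth_subring M).
HB.instance Definition _ n (M : manifold n) :=
  GRing.SubChoice_isSubComPzRing.Build _ _ (cinf M) (subringClosedP _).
HB.instance Definition _ n (M : manifold n) :=
  GRing.isSubmodClosed.Build _ _ (smooth_pred M) (smooth_submod M).
HB.instance Definition _ n (M : manifold n) :=
  [SubZmodule_isSubLmodule of cinf M by <:].

(* The tangent space at p is the space of derivations at p of the algebra of
   smooth functions. *)
Definition derivation n (M : manifold n) (p : M) (v : cinf M -> R^o) : Prop :=
  (forall a h k, v (a *: h + k) = a * v h + v k) /\
  (forall h k, v (h * k) = h p * v k + k p * v h).

Definition derivation_pred n (M : manifold n) p : {pred cinf M -> R^o} :=
  fun v => `[< derivation p v >].

Arguments derivation_pred {n M} p _.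

Record tangent n (M : manifold n) (p : M) := Tangent {
  tangent_fun :> cinf M -> R^o;
  tangent_in : tangent_fun \in derivation_pred p }.

HB.instance Definition _ n (M : manifold n) p :=
  [isSub of tangent p for @tangent_fun n M p].
HB.instance Definition _ n (M : manifold n) (p : M) := [Choice of tangent p by <:].

Lemma derivation_submod n (M : manifold n) (p : M) :
  submod_closed (derivation_pred p).
Proof.
split=> [|a v w /asboolP[vl vm] /asboolP[wl wm]]; apply/asboolP; split.
- by move=> a h k /=; rewrite mulr0 addr0.
- by move=> h k /=; rewrite !mulr0 addr0.
- move=> b h k; change (a * v (b *: h + k) + w (b *: h + k) =
    b * (a * v h + w h) + (a * v k + w k)).
  by rewrite vl wl; ring.
- move=> h k; change (a * v (h * k) + w (h * k) =
    h p * (a * v k + w k) + k p * (a * v h + w h)).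
  by rewrite vm wm; ring.
Qed.

HB.instance Definition _ n (M : manifold n) (p : M) :=
  GRing.isSubmodClosed.Build _ _ (derivation_pred p) (derivation_submod p).
HB.instance Definition _ n (M : manifold n) (p : M) :=
  [SubChoice_isSubLmodule of tangent p by <:].


Lemma tangentP n (M : manifold n) (p : M) (v : tangent p) : derivation p v.
Proof. exact/asboolP/tangent_in. Qed.

Definition mk_tangent n (M : manifold n) (p : M) (v : cinf M -> R)
    (vd : derivation p v) : tangent p :=
  Tangent (introT (asboolP _) vd : v \in derivation_pred p).

(* v = sum_i a_i d/dx^i at p, where x^1, .., x^n are the coordinates of c; only
   meaningful for p in the domain of c. *)
Definition has_coords n (M : manifold n) (c : chart M n) (p : M)
    (v : tangent p) (a : 'rV[R]_n) : Prop :=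
  forall h : cinf M,
    v h = \sum_(i < n) a 0 i * 'D_'e_i ((h : M -> R) \o chart_inv c) (c p).

(* Smooth sections of the tangent bundle; smoothness says that the components in
   each chart, as functions of the coordinates, are smooth. *)
Record vector_field n (M : manifold n) := VectorField {
  vf :> forall p : M, tangent p;
  vf_smooth : forall c, atlas c -> exists2 a : 'rV[R]_n -> 'rV[R]_n,
    forall i, smooth_on (im c) (fun x => a x 0 i) &
    forall p, dom c p -> has_coords c (vf p) (a (c p)) }.

(* Smooth symmetric (0,2)-tensors, with no condition on rank or signature; in
   each chart g = sum_ij G_ij dx^i dx^j with smooth G_ij. *)
Record singular_metric n (M : manifold n) := SingularMetric {
  singular_form :> forall p : M, tangent p -> tangent p -> R;
  singular_linear : forall p a (u v w : tangent p),
    singular_form (a *: u + v) w = a * singular_form u w + singular_form v w;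
  singular_sym : forall p (v w : tangent p), singular_form v w = singular_form w v;
  singular_smooth : forall c, atlas c -> exists2 G : 'rV[R]_n -> 'M[R]_n,
    forall i j, smooth_on (im c) (fun x => G x i j) &
    forall p (v w : tangent p) a b, dom c p ->
      has_coords c v a -> has_coords c w b ->
      singular_form v w = \sum_(i < n) \sum_(j < n) a 0 i * b 0 j * G (c p) i j }.

Lemma vf_app_subproof n (M : manifold n) (X : vector_field M) (h : cinf M) :
  smooth (fun p => X p h).
Proof.
move=> c ac; have [a as_ aX] := vf_smooth X ac.
apply: (smooth_on_ext (f := fun x =>
  \sum_(i < n) a x 0 i * 'D_'e_i ((h : M -> R) \o chart_inv c) x)).
- exact: im_is_open.
- by move=> _ [p dp <-] /=; rewrite chart_mapK// aX.
- apply: smooth_on_sum; first exact: im_is_open.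
  move=> i; apply: smooth_onM; [exact: im_is_open|exact: as_|].
  by apply: smooth_on_derive; exact: cinf_smooth.
Qed.

Definition vf_app n (M : manifold n) (X : vector_field M) (h : cinf M) :=
  mk_cinf (vf_app_subproof X h).

Lemma inner_subproof n (M : manifold n) (g : singular_metric M) (X Y : vector_field M) :
  smooth (fun p => g p (X p) (Y p)).
Proof.
move=> c ac; have [a as_ aX] := vf_smooth X ac.
have [b bs bY] := vf_smooth Y ac; have [G Gs GE] := singular_smooth g ac.
apply: (smooth_on_ext (f := fun x =>
  \sum_(i < n) \sum_(j < n) a x 0 i * b x 0 j * G x i j)).
- exact: im_is_open.
- move=> _ [p dp <-] /=; rewrite chart_mapK//; apply/esym.
  by apply: GE => //; [exact: aX|exact: bY].
- have o := @im_is_open M n c.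
  by do 2 (apply: smooth_on_sum => // ?); apply: smooth_onM => //; apply: smooth_onM.
Qed.

(* The smooth function <X, Y>. *)
Definition inner n (M : manifold n) (g : singular_metric M) (X Y : vector_field M) :=
  mk_cinf (inner_subproof g X Y).

Lemma bracket_subproof n (M : manifold n) (X Y : vector_field M) (p : M) :
  derivation p (fun h => X p (vf_app Y h) - Y p (vf_app X h)).
Proof.
have vfZ (Z : vector_field M) a h k :
    vf_app Z (a *: h + k) = a *: vf_app Z h + vf_app Z k.
  by apply/val_inj/funext => q; have [+ _] := tangentP (Z q); apply.
have vfM (Z : vector_field M) h k :
    vf_app Z (h * k) = h * vf_app Z k + k * vf_app Z h.
  by apply/val_inj/funext => q; have [_] := tangentP (Z q); apply.
have [Xl Xm] := tangentP (X p); have [Yl Ym] := tangentP (Y p).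
have tD q (v : tangent q) h k : v (h + k) = v h + v k.
  by have [+ _] := tangentP v; move=> /(_ 1 h k); rewrite scale1r mul1r.
split=> [a h k|h k]; first by rewrite !vfZ Xl Yl; ring.
by rewrite !vfM !tD !Xm !Ym /=; ring.
Qed.

Definition bracket n (M : manifold n) (X Y : vector_field M) (p : M) :
  tangent p := mk_tangent (bracket_subproof X Y p).

Definition koszul n (M : manifold n) (g : singular_metric M) (X Y Z : vector_field M)
    (p : M) : R :=
  2^-1 * (X p (inner g Y Z) + Y p (inner g Z X) - Z p (inner g X Y)
          - g p (X p) (bracket Y Z p) + g p (Y p) (bracket Z X p)
          + g p (Z p) (bracket X Y p)).

(* The semi-symmetric metric Koszul form associated with P. *)
Definition ss_koszul n (M : manifold n) (g : singular_metric M) (P X Y Z : vector_field M)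
    (p : M) : R :=
  koszul g X Y Z p + g p (Y p) (P p) * g p (X p) (Z p)
                   - g p (X p) (Y p) * g p (P p) (Z p).

End manifolds.

Arguments chart : clear implicits.
Arguments manifold : clear implicits.

Section products.
Context {R : realType}.
Implicit Types m n : nat.

Lemma prod_hausdorff (T U : topologicalType) :
  hausdorff_space T -> hausdorff_space U -> hausdorff_space (T * U)%type.
Proof.
move=> hT hU [a b] [c d] cl; congr pair.
  apply: hT => A C nA nC.
  have [] := cl (A `*` setT) (C `*` setT); first by exists (A, setT) => //; split=> //; exact: filterT.
    by exists (C, setT) => //; split=> //; exact: filterT.
  by move=> [x y] [[Ax _] [Cx _]]; exists x.
apply: hU => A C nA nC.
have [] := cl (setT `*` A) (setT `*` C); first by exists (setT, A) => //; split=> //; exact: filterT.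
  by exists (setT, C) => //; split=> //; exact: filterT.
by move=> [x y] [[_ Ay] [_ Cy]]; exists y.
Qed.

Lemma openX (T U : topologicalType) (A : set T) (B : set U) :
  open A -> open B -> open (A `*` B).
Proof.
move=> oA oB; rewrite openE => -[x y] [/= Ax By].
by exists (A, B) => //; split; exact: open_nbhs_nbhs.
Qed.

Lemma prod_second_countable (T U : topologicalType) :
  @second_countable T -> @second_countable U ->
  @second_countable (T * U)%type.
Proof.
move=> [A cA [Ao An]] [B cB [Bo Bn]].
exists ((fun V => V.1 `*` V.2) @` (A `*` B)).
  by apply: card_le_trans (card_image_le _ _) _; exact: countableX.
split; first by move=> _ [[V W] /= [AV BW] <-]; apply: openX; [exact: Ao|exact: Bo].
move=> [x y] P [[V W] /= [nV nW] VWP].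
have [V' [AV' V'x] V'V] := An x V nV.
have [W' [BW' W'y] W'W] := Bn y W nW.
exists (V' `*` W').
  by split=> //; exists (V', W').
by move=> [u v] [/= /V'V Vu /W'W Wv]; exact: VWP.
Qed.

Section prod_chart.
Context m n (B F : topologicalType) (c : chart R B m) (d : chart R F n).

Let dom2 : set (B * F) := dom c `*` dom d.
Let coord2 (z : B * F) : 'rV[R]_(m + n) := row_mx (c z.1) (d z.2).
Let param2 (x : 'rV[R]_(m + n)) : B * F := (chart_inv c (lsubmx x), chart_inv d (rsubmx x)).

Let im2 : coord2 @` dom2 = lsubmx @^-1` im c `&` rsubmx @^-1` im d.
Proof.
rewrite eqEsubset; split=> [_ [[p q] [/= dp dq] <-]|x [/= [p dp px] [q dq qx]]].
  by split; rewrite /= ?row_mxKl ?row_mxKr; [exists p|exists q].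
by exists (p, q) => //=; rewrite /coord2 /= px qx hsubmxK.
Qed.

Fact prod_dom_open : open dom2.
Proof. by apply: openX; exact: chart_dom_open. Qed.

Fact prod_im_open : open (coord2 @` dom2).
Proof.
rewrite im2; apply: openI; (apply: open_comp; last exact: im_is_open) => x _.
  by have [+ _] := @lsubmx_affine R m n; apply.
by have [+ _] := @rsubmx_affine R m n; apply.
Qed.

Fact prod_coordK p : dom2 p -> param2 (coord2 p) = p.
Proof.
case: p => p q [/= dp dq]; rewrite /param2 /coord2 /= row_mxKl row_mxKr.
by rewrite !chart_mapK.
Qed.

Fact prod_coord_cont p : dom2 p -> {for p, continuous coord2}.
Proof.
case: p => p q [/= dp dq]; apply: mx_continuous => i j.
case: (split_ordP j) => k ->.
  rewrite (_ : (fun z => _) = (fun x : 'rV[R]_m => x i k) \o (c \o fst)).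
    apply: continuous_comp; last exact: coord_continuous.
    by apply: continuous_comp; [exact: cvg_fst|exact: chart_map_cont].
  by apply/funext => z; rewrite /coord2 row_mxEl.
rewrite (_ : (fun z => _) = (fun x : 'rV[R]_n => x i k) \o (d \o snd)).
  apply: continuous_comp; last exact: coord_continuous.
  by apply: continuous_comp; [exact: cvg_snd|exact: chart_map_cont].
by apply/funext => z; rewrite /coord2 row_mxEr.
Qed.

Fact prod_param_cont x : (coord2 @` dom2) x -> {for x, continuous param2}.
Proof.
rewrite im2 => -[/= xc xd].
have cl : {for x, continuous (chart_inv c \o lsubmx)}.
  apply: continuous_comp; last exact: chart_inv_cont.
  by have [+ _] := @lsubmx_affine R m n; apply.
have cr : {for x, continuous (chart_inv d \o rsubmx)}.
  apply: continuous_comp; last exact: chart_inv_cont.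
  by have [+ _] := @rsubmx_affine R m n; apply.
exact: cvg_pair cl cr.
Qed.

Definition prod_chart : chart R (B * F)%type (m + n) :=
  Chart prod_dom_open prod_im_open prod_coordK prod_coord_cont prod_param_cont.

Lemma im_prod_chart x : im prod_chart x <-> im c (lsubmx x) /\ im d (rsubmx x).
Proof. by have -> : im prod_chart = coord2 @` dom2 by []; rewrite im2. Qed.

End prod_chart.

Section prod_manifold.
Context m n (B : manifold R m) (F : manifold R n).

Definition prod_atlas : set (chart R (B * F)%type (m + n)) :=
  [set e | exists c d, [/\ atlas c, atlas d & e = prod_chart c d]].

Fact prod_cover (p : (B * F)%type) : exists2 c, prod_atlas c & dom c p.
Proof.
case: p => p q; have [c ac cp] := atlas_cover p; have [d ad dq] := atlas_cover q.
by exists (prod_chart c d) => //; exists c, d.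
Qed.

Fact prod_compat c d : prod_atlas c -> prod_atlas d -> forall j,
  smooth_on (c @` (dom c `&` dom d)) (fun x => d (chart_inv c x) 0 j).
Proof.
move=> [c1 [c2 [a1 a2 ->]]] [d1 [d2 [b1 b2 ->]]] j.
case: (split_ordP j) => k ->.
  rewrite (_ : (fun x => _) = (fun x => d1 (chart_inv c1 x) 0 k) \o lsubmx).
    apply: smooth_on_affine (atlas_compat a1 b1 k); first exact: lsubmx_affine.
    by move=> _ [[p q] [[/= ? ?] [/= ? ?]] <-] /=; rewrite row_mxKl; exists p.
  by apply/funext => x /=; rewrite row_mxEl.
rewrite (_ : (fun x => _) = (fun x => d2 (chart_inv c2 x) 0 k) \o rsubmx).
  apply: smooth_on_affine (atlas_compat a2 b2 k); first exact: rsubmx_affine.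
  by move=> _ [[p q] [[/= ? ?] [/= ? ?]] <-] /=; rewrite row_mxKr; exists q.
by apply/funext => x /=; rewrite row_mxEr.
Qed.

Definition prod_manifold : manifold R (m + n) :=
  Manifold (prod_hausdorff (@manifold_hausdorff _ _ B) (@manifold_hausdorff _ _ F))
    (prod_second_countable (@manifold_second_countable _ _ B)
       (@manifold_second_countable _ _ F))
    prod_cover prod_compat.

End prod_manifold.

Record smooth_map m n (M : manifold R m) (N : manifold R n) := SmoothMap {
  smap :> M -> N;
  smap_cont : continuous smap;
  smap_pull : forall h : N -> R, smooth h -> smooth (h \o smap) }.

Definition pullback m n (M : manifold R m) (N : manifold R n) (phi : smooth_map M N)
  (h : cinf N) : cinf M := mk_cinf (smap_pull phi (cinf_smooth h)).

Fact differential_subproof m n (M : manifold R m) (N : manifold R n)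
    (phi : smooth_map M N) (p : M) (v : tangent p) :
  derivation (phi p) (fun h => v (pullback phi h)).
Proof.
have [vl vm] := tangentP v; split=> [a h k|h k].
  by rewrite -vl; congr (v _); exact/val_inj.
by rewrite -(vm (pullback phi h)); congr (v _); exact/val_inj.
Qed.

Definition differential m n (M : manifold R m) (N : manifold R n)
    (phi : smooth_map M N) (p : M) (v : tangent p) : tangent (phi p) :=
  mk_tangent (differential_subproof phi v).

Lemma differential_linear m n (M : manifold R m) (N : manifold R n)
    (phi : smooth_map M N) (p : M) (a : R) (v w : tangent p) :
  differential phi (a *: v + w) = a *: differential phi v + differential phi w.
Proof. exact/val_inj. Qed.

Section warped.
Context m n (B : manifold R m) (F : manifold R n).
Notation BF := (prod_manifold B F).

Fact fst_smooth (h : B -> R) : smooth h -> smooth (M := BF) (h \o fst).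
Proof.
move=> hs _ [c [d [ac ad ->]]].
apply: smooth_on_affine (hs c ac); first exact: lsubmx_affine.
by move=> x /im_prod_chart[].
Qed.

Fact snd_smooth (h : F -> R) : smooth h -> smooth (M := BF) (h \o snd).
Proof.
move=> hs _ [c [d [ac ad ->]]].
apply: smooth_on_affine (hs d ad); first exact: rsubmx_affine.
by move=> x /im_prod_chart[].
Qed.

Definition projB : smooth_map BF B :=
  @SmoothMap _ _ BF B fst (fun z => cvg_fst) fst_smooth.
Definition projF : smooth_map BF F :=
  @SmoothMap _ _ BF F snd (fun z => cvg_snd) snd_smooth.

Lemma inclB_param (q : F) (c : chart R B m) (d : chart R F n) x : dom d q ->
  (chart_inv c x, q) = chart_inv (prod_chart c d) (row_mx x (d q)) :> B * F.
Proof. by move=> dq; rewrite /= row_mxKl row_mxKr chart_mapK. Qed.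

Lemma inclF_param (p : B) (c : chart R B m) (d : chart R F n) x : dom c p ->
  (p, chart_inv d x) = chart_inv (prod_chart c d) (row_mx (c p) x) :> B * F.
Proof. by move=> dp; rewrite /= row_mxKl row_mxKr chart_mapK. Qed.

Fact inclB_smooth (q : F) (h : BF -> R) :
  smooth h -> smooth (fun p => h (p, q)).
Proof.
move=> hs c ac; have [d ad dq] := atlas_cover q.
rewrite (_ : _ \o _ = (h \o chart_inv (prod_chart c d)) \o (fun x => row_mx x (d q))).
  apply: smooth_on_affine (hs (prod_chart c d) _).
  - exact: row_mx_affinel.
  - by move=> x ix; apply/im_prod_chart; rewrite row_mxKl row_mxKr; split=> //; exists q.
  - by exists c, d.
by apply/funext => x; exact: (congr1 h (inclB_param _ _ dq)).
Qed.

Fact inclF_smooth (p : B) (h : BF -> R) :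
  smooth h -> smooth (fun q => h (p, q)).
Proof.
move=> hs d ad; have [c ac cp] := atlas_cover p.
rewrite (_ : _ \o _ = (h \o chart_inv (prod_chart c d)) \o row_mx (c p)).
  apply: smooth_on_affine (hs (prod_chart c d) _).
  - exact: row_mx_affiner.
  - by move=> x ix; apply/im_prod_chart; rewrite row_mxKl row_mxKr; split=> //; exists p.
  - by exists c, d.
by apply/funext => x; exact: (congr1 h (inclF_param _ _ cp)).
Qed.

Definition inclB (q : F) : smooth_map B BF :=
  @SmoothMap _ _ B BF (fun p => (p, q)) (fun p => cvg_pair cvg_id (cvg_cst q))
    (inclB_smooth q).
Definition inclF (p : B) : smooth_map F BF :=
  @SmoothMap _ _ F BF (fun q => (p, q)) (fun q => cvg_pair (cvg_cst p) cvg_id)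
    (inclF_smooth p).

(* The lift to z of a vector v tangent to B at z.1 is its image under the
   differential of the inclusion p |-> (p, z.2); likewise for F. *)
Fact lift_vecB_subproof (z : BF) (v : tangent z.1) :
  derivation z (fun h : cinf BF => v (pullback (inclB z.2) h)).
Proof. by case: z v => p q v; exact: (@differential_subproof _ _ B BF (inclB q) p v). Qed.

Definition lift_vecB (z : BF) (v : tangent z.1) : tangent z :=
  mk_tangent (lift_vecB_subproof v).

Fact lift_vecF_subproof (z : BF) (v : tangent z.2) :
  derivation z (fun h : cinf BF => v (pullback (inclF z.1) h)).
Proof. by case: z v => p q v; exact: (@differential_subproof _ _ F BF (inclF p) q v). Qed.

Definition lift_vecF (z : BF) (v : tangent z.2) : tangent z :=
  mk_tangent (lift_vecF_subproof v).

Fact liftB_smooth (X : vector_field B) c : atlas c ->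
  exists2 a : 'rV[R]_(m + n) -> 'rV[R]_(m + n),
    forall i, smooth_on (im c) (fun x => a x 0 i) &
    forall z : BF, dom c z ->
      has_coords c (lift_vecB (z := z) (X z.1)) (a (c z)).
Proof.
move=> [c1 [d1 [ac ad ->]]]; have [a as_ aX] := vf_smooth X ac.
exists (fun x => row_mx (a (lsubmx x)) 0) => [i|[p q] [/= dp dq] h /=].
  case: (split_ordP i) => k ->.
    rewrite (_ : (fun x => _) = (fun x => a x 0 k) \o lsubmx).
      apply: smooth_on_affine (as_ k); first exact: lsubmx_affine.
      by move=> x /im_prod_chart[].
    by apply/funext => x; rewrite row_mxEl.
  rewrite (_ : (fun x => _) = fun=> 0); first exact: smooth_on_cst.
  by apply/funext => x; rewrite row_mxEr mxE.
rewrite big_split_ord /= [X in _ + X]big1 ?addr0; last first.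
  by move=> i _; rewrite row_mxEr mxE mul0r.
rewrite aX//; apply: eq_bigr => i _; rewrite row_mxEl row_mxKl; congr (_ * _).
have -> : (pullback (inclB q) h : B -> R) \o chart_inv c1 =
    ((h : BF -> R) \o chart_inv (prod_chart c1 d1)) \o (fun x => row_mx x (d1 q)).
  by apply/funext => x; exact: (congr1 h (inclB_param _ _ dq)).
have A t x : row_mx (t *: 'e_i + x) (d1 q) =
    t *: 'e_(lshift n i) + row_mx x (d1 q) :> 'rV[R]_(m + n).
  by rewrite -row_mx_deltal row_mx_addl.
have [_ E] := derive_affine ((h : BF -> R) \o chart_inv (prod_chart c1 d1)) A.
exact: (congr1 (@^~ (c1 p)) E).
Qed.

Fact liftF_smooth (X : vector_field F) c : atlas c ->
  exists2 a : 'rV[R]_(m + n) -> 'rV[R]_(m + n),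
    forall i, smooth_on (im c) (fun x => a x 0 i) &
    forall z : BF, dom c z ->
      has_coords c (lift_vecF (z := z) (X z.2)) (a (c z)).
Proof.
move=> [c1 [d1 [ac ad ->]]]; have [a as_ aX] := vf_smooth X ad.
exists (fun x => row_mx 0 (a (rsubmx x))) => [i|[p q] [/= dp dq] h /=].
  case: (split_ordP i) => k ->.
    rewrite (_ : (fun x => _) = fun=> 0); first exact: smooth_on_cst.
    by apply/funext => x; rewrite row_mxEl mxE.
  rewrite (_ : (fun x => _) = (fun x => a x 0 k) \o rsubmx).
    apply: smooth_on_affine (as_ k); first exact: rsubmx_affine.
    by move=> x /im_prod_chart[].
  by apply/funext => x; rewrite row_mxEr.
rewrite big_split_ord /= [X in X + _]big1 ?add0r; last first.
  by move=> i _; rewrite row_mxEl mxE mul0r.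
rewrite aX//; apply: eq_bigr => i _; rewrite row_mxEr row_mxKr; congr (_ * _).
have -> : (pullback (inclF p) h : F -> R) \o chart_inv d1 =
    ((h : BF -> R) \o chart_inv (prod_chart c1 d1)) \o (fun x => row_mx (c1 p) x).
  by apply/funext => x; exact: (congr1 h (inclF_param _ _ dp)).
have A t x : row_mx (c1 p) (t *: 'e_i + x) =
    t *: 'e_(rshift m i) + row_mx (c1 p) x :> 'rV[R]_(m + n).
  by rewrite -row_mx_deltar row_mx_addr.
have [_ E] := derive_affine ((h : BF -> R) \o chart_inv (prod_chart c1 d1)) A.
exact: (congr1 (@^~ (d1 q)) E).
Qed.

Definition liftB (X : vector_field B) : vector_field BF :=
  VectorField (liftB_smooth X).
Definition liftF (U : vector_field F) : vector_field BF :=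
  VectorField (liftF_smooth U).

Lemma differential_projB_coords (c : chart R B m) (d : chart R F n) (z : BF)
    (v : tangent z) a :
  has_coords (M := BF) (prod_chart c d) v a ->
  has_coords c (differential projB v) (lsubmx a).
Proof.
move=> va h; rewrite [LHS]va big_split_ord /= [X in _ + X]big1 ?addr0.
  apply: eq_bigr => i _; rewrite mxE; congr (_ * _).
  have A t x : lsubmx (t *: 'e_(lshift n i) + x : 'rV[R]_(m + n)) =
      t *: 'e_i + lsubmx x.
    by rewrite linearP /= -row_mx_deltal row_mxKl.
  have [_ E] := derive_affine ((h : B -> R) \o chart_inv c) A.
  by rewrite [LHS](congr1 (@^~ (prod_chart c d z)) E) /= row_mxKl.
move=> i _; rewrite [X in _ * X](_ : _ = 0) ?mulr0//.
have A t x : lsubmx (t *: 'e_(rshift m i) + x : 'rV[R]_(m + n)) =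
    t *: 0 + lsubmx x.
  by rewrite linearP /= -row_mx_deltar row_mxKl.
have [_ E] := derive_affine ((h : B -> R) \o chart_inv c) A.
by rewrite [LHS](congr1 (@^~ (prod_chart c d z)) E) derive0.
Qed.

Lemma differential_projF_coords (c : chart R B m) (d : chart R F n) (z : BF)
    (v : tangent z) a :
  has_coords (M := BF) (prod_chart c d) v a ->
  has_coords d (differential projF v) (rsubmx a).
Proof.
move=> va h; rewrite [LHS]va big_split_ord /= [X in X + _]big1 ?add0r.
  apply: eq_bigr => i _; rewrite mxE; congr (_ * _).
  have A t x : rsubmx (t *: 'e_(rshift m i) + x : 'rV[R]_(m + n)) =
      t *: 'e_i + rsubmx x.
    by rewrite linearP /= -row_mx_deltar row_mxKr.
  have [_ E] := derive_affine ((h : F -> R) \o chart_inv d) A.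
  by rewrite [LHS](congr1 (@^~ (prod_chart c d z)) E) /= row_mxKr.
move=> i _; rewrite [X in _ * X](_ : _ = 0) ?mulr0//.
have A t x : rsubmx (t *: 'e_(lshift n i) + x : 'rV[R]_(m + n)) =
    t *: 0 + rsubmx x.
  by rewrite linearP /= -row_mx_deltal row_mxKr.
have [_ E] := derive_affine ((h : F -> R) \o chart_inv d) A.
by rewrite [LHS](congr1 (@^~ (prod_chart c d z)) E) derive0.
Qed.

Lemma tangent_cst k (M : manifold R k) (p : M) (v : tangent p) (h : cinf M) a :
  (forall q, h q = a) -> v h = 0.
Proof.
have [vl vm] := tangentP v => ha.
have -> : h = a *: (1 : cinf M) + 0.
  by apply/val_inj/funext => q /=; rewrite ha [RHS]addr0 [RHS]mulr1.
have v0 : v 0 = 0.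
  have := vl 0 0 0; rewrite scale0r addr0 mul0r add0r => E.
  by have := vl 1 0 0; rewrite scale1r addr0 mul1r => /(congr1 (+%R^~ (- v 0)));
    rewrite subrr addrK.
have v1 : v 1 = 0.
  have := vm 1 1; rewrite mul1r [(1 : cinf M) p]/= !mul1r.
  by move=> /(congr1 (+%R^~ (- v 1))); rewrite subrr addrK.
by rewrite vl v0 v1 mulr0 addr0.
Qed.

Lemma projB_liftB (X : vector_field B) (z : BF) :
  differential projB (liftB X z) = X z.1.
Proof. by apply/val_inj/funext => h /=; congr (X z.1 _); exact/val_inj. Qed.

Lemma projF_liftB (X : vector_field B) (z : BF) :
  differential projF (liftB X z) = 0.
Proof.
apply/val_inj/funext => h.
exact: (@tangent_cst _ _ _ (X z.1) (pullback (inclB z.2) (pullback projF h))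
  (h z.2)).
Qed.

Lemma projF_liftF (U : vector_field F) (z : BF) :
  differential projF (liftF U z) = U z.2.
Proof. by apply/val_inj/funext => h /=; congr (U z.2 _); exact/val_inj. Qed.

Lemma projB_liftF (U : vector_field F) (z : BF) :
  differential projB (liftF U z) = 0.
Proof.
apply/val_inj/funext => h.
exact: (@tangent_cst _ _ _ (U z.2) (pullback (inclF z.1) (pullback projB h))
  (h z.1)).
Qed.

Section warped_metric.
Variables (gB : singular_metric B) (gF : singular_metric F) (f : cinf B).

(* pi_B^* gB + (f o pi_B)^2 pi_F^* gF *)
Definition warped_form (z : BF) (v w : tangent z) : R :=
  gB (projB z) (differential projB v) (differential projB w)
  + (f (projB z)) ^+ 2
    * gF (projF z) (differential projF v) (differential projF w).

Fact warped_linear (z : BF) a (u v w : tangent z) :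
  warped_form (a *: u + v) w = a * warped_form u w + warped_form v w.
Proof. by rewrite /warped_form !differential_linear !singular_linear; ring. Qed.

Fact warped_sym (z : BF) (v w : tangent z) : warped_form v w = warped_form w v.
Proof. by rewrite /warped_form singular_sym (singular_sym gF). Qed.

Fact warped_smooth (e : chart R BF (m + n)) : atlas e ->
  exists2 G : 'rV[R]_(m + n) -> 'M[R]_(m + n),
    forall i j, smooth_on (im e) (fun x => G x i j) &
    forall (z : BF) (v w : tangent z) a b, dom e z ->
      has_coords e v a -> has_coords e w b ->
      warped_form v w =
        \sum_(i < m + n) \sum_(j < m + n) a 0 i * b 0 j * G (e z) i j.
Proof.
move=> [c [d [ac ad ->]]].
have [GB GBs GBE] := singular_smooth gB ac.
have [GF GFs GFE] := singular_smooth gF ad.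
exists (fun x => block_mx (GB (lsubmx x)) 0 0
  ((f (chart_inv c (lsubmx x))) ^+ 2 *: GF (rsubmx x))).
  have o : open (im (prod_chart c d)) by exact: im_is_open.
  have l x : im (prod_chart c d) x -> im c (lsubmx x) by case/im_prod_chart.
  have r x : im (prod_chart c d) x -> im d (rsubmx x) by case/im_prod_chart.
  have fs : smooth_on (im (prod_chart c d)) (fun x => f (chart_inv c (lsubmx x))).
    exact: smooth_on_affine (@lsubmx_affine R m n) l (cinf_smooth f ac).
  move=> i j; case: (split_ordP i) => i' ->; case: (split_ordP j) => j' ->.
  - under eq_fun do rewrite block_mxEul.
    exact: (smooth_on_affine (@lsubmx_affine R m n) l (GBs i' j')).
  - by under eq_fun do rewrite block_mxEur mxE; exact: smooth_on_cst.
  - by under eq_fun do rewrite block_mxEdl mxE; exact: smooth_on_cst.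
  - under eq_fun do rewrite block_mxEdr mxE expr2.
    apply: smooth_onM => //; first exact: smooth_onM.
    exact: (smooth_on_affine (@rsubmx_affine R m n) r (GFs i' j')).
move=> z v w a b [dz1 dz2] va wb; rewrite /warped_form.
rewrite (GBE _ _ _ _ _ dz1 (differential_projB_coords va)
  (differential_projB_coords wb)).
rewrite (GFE _ _ _ _ _ dz2 (differential_projF_coords va)
  (differential_projF_coords wb)).
rewrite big_split_ord /=; congr (_ + _).
  apply: eq_bigr => i _; rewrite big_split_ord /= [X in _ = _ + X]big1 ?addr0.
    by apply: eq_bigr => j _; rewrite block_mxEul /= row_mxKl !mxE.
  by move=> j _; rewrite block_mxEur mxE mulr0.
rewrite mulr_sumr; apply: eq_bigr => i _; rewrite mulr_sumr.
rewrite big_split_ord /= [X in _ = X + _]big1 ?add0r.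
  apply: eq_bigr => j _; rewrite block_mxEdr /= row_mxKl row_mxKr chart_mapK//.
  by rewrite !mxE; ring.
by move=> j _; rewrite block_mxEdl mxE mulr0.
Qed.

Definition warped_metric : singular_metric BF :=
  SingularMetric warped_linear warped_sym warped_smooth.

End warped_metric.
End warped.
End products.

(* Main.v *)
(* The lift of a field on one factor is related to that field by one projection
   and to the zero field by the other.  As the bracket respects relatedness,
   brackets of lifts project to brackets on the factors, those of lifts from
   different factors to zero; inner products of lifts are pulled back from the
   factors, up to f^2.  So each term of the Koszul form is either zero or known,
   and only X(f^2) = 2 f X(f) produces a derivative of f. *)

Require Import Defs.
From mathcomp Require Import all_boot all_order all_algebra.
From mathcomp Require Import boolp classical_sets functions.
From mathcomp Require Import reals topology normedtype derive.
From mathcomp Require Import ring.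
Import GRing.Theory.
Local Open Scope ring_scope.

(** * Degenerate forms at the zero vector, and brackets with the zero field *)

Section manifold.
Context {R : realType} {n : nat} {M : manifold R n}.
Implicit Types (X Y : vector_field M) (g : singular_metric M).

Lemma singular0l g p (v : tangent p) : g p 0 v = 0.
Proof.
have := singular_linear g 1 0 0 v.
by rewrite scale1r addr0 mul1r => /eqP; rewrite -subr_eq subrr => /eqP.
Qed.

Lemma singular0r g p (v : tangent p) : g p v 0 = 0.
Proof. by rewrite singular_sym singular0l. Qed.

Fact vf0_smooth c : atlas c ->
  exists2 a : 'rV[R]_n -> 'rV[R]_n,
    forall i, smooth_on (im c) (fun x => a x 0 i) &
    forall p, dom c p -> has_coords c (0 : @tangent _ _ M p) (a (c p)).
Proof.
move=> _; exists (fun=> 0) => [i|p _ h].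
  by under eq_fun do rewrite mxE; exact: smooth_on_cst.
by rewrite big1 // => i _; rewrite mxE mul0r.
Qed.

(** Packaged as a genuine [vector_field] so that a lift can be related to it under the projection to
    the other factor; [bracket_related] then covers mixed brackets too. *)
Definition vf0 : vector_field M := VectorField vf0_smooth.

(** One term of the commutator vanishes by computation; the other differentiates [vf_app vf0 h],
    which is constant. *)
Lemma bracket0l Y p : bracket vf0 Y p = 0.
Proof.
apply/val_inj/funext => h; change (0 - Y p (vf_app vf0 h) = 0).
by rewrite (@tangent_cst _ _ _ _ (Y p) (vf_app vf0 h) 0) ?subrr.
Qed.

Lemma bracket0r X p : bracket X vf0 p = 0.
Proof.
apply/val_inj/funext => h; change (X p (vf_app vf0 h) - 0 = 0).
by rewrite (@tangent_cst _ _ _ _ (X p) (vf_app vf0 h) 0) ?subrr.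
Qed.

End manifold.

(** * Related vector fields *)

Definition vf_related {R : realType} {m n : nat} {M : manifold R m}
    {N : manifold R n} (phi : smooth_map M N)
    (X : vector_field M) (Y : vector_field N) : Prop :=
  forall z, differential phi (X z) = Y (phi z).

(** Relatedness means that pulling functions back along [phi] intertwines the two fields as
    derivations, hence also their commutators. *)
Lemma bracket_related {R : realType} {m n : nat} {M : manifold R m}
    {N : manifold R n} {phi : smooth_map M N}
    {X1 X2 : vector_field M} {Y1 Y2 : vector_field N} :
  vf_related phi X1 Y1 -> vf_related phi X2 Y2 ->
  forall z, differential phi (bracket X1 X2 z) = bracket Y1 Y2 (phi z).
Proof.
have app X Y h (XY : vf_related phi X Y) :
    vf_app X (pullback phi h) = pullback phi (vf_app Y h).
  by apply/val_inj/funext => z; exact: (congr1 (@^~ h) (congr1 val (XY z))).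
move=> r1 r2 z; apply/val_inj/funext => h.
change (X1 z (vf_app X2 (pullback phi h)) - X2 z (vf_app X1 (pullback phi h)) =
  Y1 (phi z) (vf_app Y2 h) - Y2 (phi z) (vf_app Y1 h)).
by rewrite (app _ _ h r1) (app _ _ h r2) -r1 -r2.
Qed.

(** * Values of the warped metric on lifts *)

Section warped_product.
Context {R : realType} {m n : nat} {B : manifold R m} {F : manifold R n}.
Context (gB : singular_metric B) (gF : singular_metric F) (f : cinf B).
Notation BF := (prod_manifold B F).
Notation g := (warped_metric gB gF f).
Notation piB := (projB B F).
Notation piF := (projF B F).
Implicit Types (X Y : vector_field B) (U V W : vector_field F) (z : BF).

Lemma liftB_relatedB X : vf_related piB (liftB F X) X.
Proof. exact: projB_liftB. Qed.

Lemma liftB_relatedF X : vf_related piF (liftB F X) vf0.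
Proof. exact: projF_liftB. Qed.

Lemma liftF_relatedB U : vf_related piB (liftF B U) vf0.
Proof. exact: projB_liftF. Qed.

Lemma liftF_relatedF U : vf_related piF (liftF B U) U.
Proof. exact: projF_liftF. Qed.

(** The second vector is left arbitrary so that the formula serves both lifts and brackets of
    lifts. *)
Lemma warpedBl X z (v : tangent z) :
  g z (liftB F X z) v = gB z.1 (X z.1) (differential piB v).
Proof.
change (warped_form gB gF f (liftB F X z) v = gB z.1 (X z.1) (differential piB v)).
by rewrite /warped_form projF_liftB singular0l mulr0 addr0 projB_liftB.
Qed.

Lemma warpedFl U z (v : tangent z) :
  g z (liftF B U z) v = f z.1 ^+ 2 * gF z.2 (U z.2) (differential piF v).
Proof.
change (warped_form gB gF f (liftF B U z) v =
  f z.1 ^+ 2 * gF z.2 (U z.2) (differential piF v)).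
by rewrite /warped_form projB_liftF singular0l add0r projF_liftF.
Qed.

Lemma warpedBB X Y z : g z (liftB F X z) (liftB F Y z) = gB z.1 (X z.1) (Y z.1).
Proof. by rewrite warpedBl projB_liftB. Qed.

Lemma warpedBF X U z : g z (liftB F X z) (liftF B U z) = 0.
Proof. by rewrite warpedBl projB_liftF singular0r. Qed.

Lemma warpedFB X U z : g z (liftF B U z) (liftB F X z) = 0.
Proof. by rewrite singular_sym warpedBF. Qed.

Lemma warpedFF U V z :
  g z (liftF B U z) (liftF B V z) = f z.1 ^+ 2 * gF z.2 (U z.2) (V z.2).
Proof. by rewrite warpedFl projF_liftF. Qed.

(** * Inner products of lifts as functions, and their derivatives *)

Lemma innerBB X Y :
  inner g (liftB F X) (liftB F Y) = pullback piB (inner gB X Y).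
Proof. by apply/val_inj/funext => z; exact: warpedBB. Qed.

(** An equality of smooth functions, with f^2 written as the product [f * f], so that tangent
    vectors can act on it by the Leibniz rule. *)
Lemma innerFF U V :
  inner g (liftF B U) (liftF B V) =
  pullback piB (f * f) * pullback piF (inner gF U V).
Proof.
by apply/val_inj/funext => z; rewrite [LHS]warpedFF expr2.
Qed.

Lemma tangent_innerBF X U z (v : tangent z) :
  v (inner g (liftB F X) (liftF B U)) = 0.
Proof. by apply: tangent_cst => y; exact: warpedBF. Qed.

Lemma tangent_innerFB X U z (v : tangent z) :
  v (inner g (liftF B U) (liftB F X)) = 0.
Proof. by apply: tangent_cst => y; exact: warpedFB. Qed.

Lemma liftB_innerBB X Y1 Y2 z :
  liftB F X z (inner g (liftB F Y1) (liftB F Y2)) = X z.1 (inner gB Y1 Y2).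
Proof.
(* Applying a vector to a pullback along [piB] is, by definition, applying its image under
   [differential piB]. *)
by rewrite innerBB; exact: (congr1 (@^~ _) (congr1 val (projB_liftB X z))).
Qed.

Lemma liftF_innerBB U Y1 Y2 z :
  liftF B U z (inner g (liftB F Y1) (liftB F Y2)) = 0.
Proof.
by rewrite innerBB; exact: (congr1 (@^~ _) (congr1 val (projB_liftF U z))).
Qed.

(** The factor coming from [F] is constant along [B]; a second use of the Leibniz rule, on [f * f],
    gives the 2. *)
Lemma liftB_innerFF X V W z :
  liftB F X z (inner g (liftF B V) (liftF B W)) =
  2 * f z.1 * X z.1 f * gF z.2 (V z.2) (W z.2).
Proof.
have [_ Xm] := tangentP (liftB F X z); have [_ Xpm] := tangentP (X z.1).
rewrite innerFF Xm.
have -> : liftB F X z (pullback piB (f * f)) = X z.1 (f * f).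
  exact: (congr1 (@^~ _) (congr1 val (projB_liftB X z))).
have -> : liftB F X z (pullback piF (inner gF V W)) = 0.
  exact: (congr1 (@^~ _) (congr1 val (projF_liftB X z))).
rewrite Xpm mulr0 add0r /=; ring.
Qed.

(** Along [F] it is f^2 that is constant. *)
Lemma liftF_innerFF U V W z :
  liftF B U z (inner g (liftF B V) (liftF B W)) =
  f z.1 ^+ 2 * U z.2 (inner gF V W).
Proof.
have [_ Um] := tangentP (liftF B U z).
rewrite innerFF Um.
have -> : liftF B U z (pullback piB (f * f)) = 0.
  exact: (congr1 (@^~ _) (congr1 val (projB_liftF U z))).
have -> : liftF B U z (pullback piF (inner gF V W)) = U z.2 (inner gF V W).
  exact: (congr1 (@^~ _) (congr1 val (projF_liftF U z))).
by rewrite mulr0 addr0 expr2.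
Qed.

(** * Brackets of lifts *)

Lemma warpedB_bracketBB X Y1 Y2 z :
  g z (liftB F X z) (bracket (liftB F Y1) (liftB F Y2) z) =
  gB z.1 (X z.1) (bracket Y1 Y2 z.1).
Proof.
by rewrite warpedBl (bracket_related (liftB_relatedB Y1) (liftB_relatedB Y2)).
Qed.

Lemma warpedB_bracketBF X Y U z :
  g z (liftB F X z) (bracket (liftB F Y) (liftF B U) z) = 0.
Proof.
rewrite warpedBl (bracket_related (liftB_relatedB Y) (liftF_relatedB U)).
by rewrite bracket0r singular0r.
Qed.

Lemma warpedB_bracketFB X Y U z :
  g z (liftB F X z) (bracket (liftF B U) (liftB F Y) z) = 0.
Proof.
rewrite warpedBl (bracket_related (liftF_relatedB U) (liftB_relatedB Y)).
by rewrite bracket0l singular0r.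
Qed.

(** Both bracketed fields are related to [vf0] on [B], so their bracket is tangent to the fibres. *)
Lemma warpedB_bracketFF X U V z :
  g z (liftB F X z) (bracket (liftF B U) (liftF B V) z) = 0.
Proof.
rewrite warpedBl (bracket_related (liftF_relatedB U) (liftF_relatedB V)).
by rewrite bracket0l singular0r.
Qed.

Lemma warpedF_bracketBB U Y1 Y2 z :
  g z (liftF B U z) (bracket (liftB F Y1) (liftB F Y2) z) = 0.
Proof.
rewrite warpedFl (bracket_related (liftB_relatedF Y1) (liftB_relatedF Y2)).
by rewrite bracket0l singular0r mulr0.
Qed.

Lemma warpedF_bracketBF U X V z :
  g z (liftF B U z) (bracket (liftB F X) (liftF B V) z) = 0.
Proof.
rewrite warpedFl (bracket_related (liftB_relatedF X) (liftF_relatedF V)).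
by rewrite bracket0l singular0r mulr0.
Qed.

Lemma warpedF_bracketFB U X V z :
  g z (liftF B U z) (bracket (liftF B V) (liftB F X) z) = 0.
Proof.
rewrite warpedFl (bracket_related (liftF_relatedF V) (liftB_relatedF X)).
by rewrite bracket0r singular0r mulr0.
Qed.

Lemma warpedF_bracketFF U V W z :
  g z (liftF B U z) (bracket (liftF B V) (liftF B W) z) =
  f z.1 ^+ 2 * gF z.2 (U z.2) (bracket V W z.2).
Proof.
by rewrite warpedFl (bracket_related (liftF_relatedF V) (liftF_relatedF W)).
Qed.

(** The three rewrite tables run through all choices of factor for each slot, so together they
    evaluate every term of a Koszul form on lifts. *)
Definition warped_innerE := (tangent_innerBF, tangent_innerFB, liftB_innerBB,
  liftF_innerBB, liftB_innerFF, liftF_innerFF).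

Definition warped_bracketE := (warpedB_bracketBB, warpedB_bracketBF,
  warpedB_bracketFB, warpedB_bracketFF, warpedF_bracketBB, warpedF_bracketBF,
  warpedF_bracketFB, warpedF_bracketFF).

Definition warpedE := (warpedBB, warpedBF, warpedFB, warpedFF).

End warped_product.

Theorem proposition2p16 (R : realType) (m n : nat)
    (B : manifold R m) (F : manifold R n)
    (gB : singular_metric B) (gF : singular_metric F) (f : cinf B)
    (X Y Z : vector_field B) (U V W P : vector_field F) :
  let K := ss_koszul (warped_metric gB gF f) (liftF B P) in
  let X' := liftB F X in let Y' := liftB F Y in let Z' := liftB F Z in
  let U' := liftF B U in let V' := liftF B V in let W' := liftF B W in
  forall (p : B) (q : F),
  [/\ K X' Y' Z' (p, q) = koszul gB X Y Z p,
      K X' Y' W' (p, q) = - K X' W' Y' (p, q) /\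
      - K X' W' Y' (p, q)
        = - (f p ^+ 2 * gB p (X p) (Y p) * gF q (P q) (W q)),
      K W' X' Y' (p, q) = 0,
      [/\ K X' V' W' (p, q) = K V' X' W' (p, q),
          K V' X' W' (p, q) = - K V' W' X' (p, q) &
          - K V' W' X' (p, q) = f p * gF q (V q) (W q) * X p f] &
      K U' V' W' (p, q)
        = f p ^+ 2 * koszul gF U V W q
          + f p ^+ 4 * gF q (V q) (P q) * gF q (U q) (W q)
          - f p ^+ 4 * gF q (U q) (V q) * gF q (P q) (W q)].
Proof.
move=> /= p q; rewrite /ss_koszul /koszul !warped_innerE !warped_bracketE !warpedE /=.
(* [field] treats values of [gF] as atoms: (2) needs one order for [P], [W], and (4) one order for
   [V], [W]. *)
rewrite (singular_sym gF (W q) (P q)) (singular_sym gF (W q) (V q)).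
(* Only identities between real numbers remain; in (4) the factor 1/2 cancels the 2 from the
   derivative of f^2. *)
by split; [field|split; field|field|split; field|field].
Qed.
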